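(* Let $H=\sum_{a\in\mathcal T}\lambda_aQ_a$ be a Pauli Hamiltonian on $n$ qubits ($d=2^n$) with $|\lambda_a|\le1$ and $|\mathrm{supp}(Q_a)|\le w$ for all $a$, such that each qubit lies in the support of at most $\ell$ terms $Q_a$. Fix an ordering $(a_1,\dots,a_M)$ of $\mathcal T$, a step size $\delta>0$, an integer $p\ge0$, and set $\beta:=(p+1)\delta$, $L:=(p+1)M$, with the periodic convention $a_{j+qM}:=a_j$. Define $\mathcal M_j(X):=e^{\delta\lambda_{a_j}Q_{a_j}}Xe^{\delta\lambda_{a_j}Q_{a_j}}$ for $j=1,\dots,L$, $A_j:=\mathcal M_j\circ\cdots\circ\mathcal M_1(\mathbb I)$, and, for an integer cutoff $k\ge1$ and an observable $O$, the weight-truncated backward propagation $O_L:=O$, $O_{j-1}:=\Pi_{<k}\big(\mathcal M_j^\dagger(O_j)\big)$ for $j=L,\dots,1$. Let $g:=2e\,\beta\,\ell\,w\,e^{\delta}$. If $g\le1$, then $$\big|\operatorname{Tr}(O_0)-\operatorname{Tr}(OA_L)\big|\le d\,e^{4\beta M}\,g^{\lceil k/w\rceil}\,\|O\|_{\mathrm{Pauli},1}.$$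
   Context: $\mathcal P_n=\{I,X,Y,Z\}^{\otimes n}$; the weight $|Q|$ of $Q\in\mathcal P_n$ is its number of non-identity factors and $\mathrm{supp}(Q)$ its set of non-identity positions. For an operator $X$, $\langle Q,X\rangle:=\frac1d\operatorname{Tr}(QX)$ and $\|X\|_{\mathrm{Pauli},1}:=\sum_{Q\in\mathcal P_n}|\langle Q,X\rangle|$. $\Pi_{<k}(X):=\sum_{|Q|<k}\langle Q,X\rangle Q$ is the projector onto the span of Pauli strings of weight $<k$. $\mathcal M_j^\dagger$ is the Hilbert–Schmidt adjoint of $\mathcal M_j$. *)

(* Defs.v *)
(* + MathComp-Analysis (limits, expR) + real_closed's complex R[i]. *)
From HB Require Import structures.
From mathcomp Require Import all_boot all_order all_algebra.
From mathcomp Require Import complex.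
From mathcomp Require Import classical_sets boolp reals topology normedtype sequences exp.

Set Implicit Arguments.
Unset Strict Implicit.
Unset Printing Implicit Defensive.

Import Order.TTheory GRing.Theory Num.Theory.
Import numFieldNormedType.Exports.
Local Open Scope ring_scope.

Section PauliDefs.
Variable R : realType.
Local Notation C := (R[i]).

(* ---------- Pauli strings on n qubits ---------- *)
(* A Pauli string Q in {I,X,Y,Z}^{⊗n}: Q i = 0,1,2,3 stands for I,X,Y,Z at qubit i. *)
Definition pauli (n : nat) := {ffun 'I_n -> 'I_4}.

Definition supp n (Q : pauli n) : {set 'I_n} := [set i | Q i != ord0].
Definition weight n (Q : pauli n) : nat := #|supp Q|.

(* single-qubit Pauli matrices, entries sigma s r c with rows/cols r,c : bool *)
Definition sigma (s : 'I_4) (r c : bool) : C :=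
  match val s with
  | 0 => if r == c then 1 else 0                                (* I *)
  | 1 => if r != c then 1 else 0                                (* X *)
  | 2 => if r == c then 0 else if r then 'i%C else - 'i%C       (* Y = [[0,-i],[i,0]] *)
  | _ => if r != c then 0 else if r then -1 else 1              (* Z *)
  end.

(* bit number j (qubit j) of a basis index r of C^(2^n) *)
Definition qbit (r j : nat) : bool := odd (r %/ 2 ^ j).

(* The 2^n x 2^n matrix of the Pauli string Q = Q_0 ⊗ ... ⊗ Q_{n-1} (entrywise). *)
Definition pmx n (Q : pauli n) : 'M[C]_(2 ^ n) :=
  \matrix_(r, c) \prod_(j < n) sigma (Q j) (qbit r j) (qbit c j).

(* ---------- Hilbert–Schmidt pairing, projector, Pauli 1-norm ---------- *)
Definition dim n : C := (2 ^ n)%:R.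

(* <Q, X> := (1/d) Tr(Q X) *)
Definition pcoef n (Q : pauli n) (X : 'M[C]_(2 ^ n)) : C :=
  (dim n)^-1 * \tr (pmx Q *m X).

(* Pi_{<k}(X) := sum_{|Q|<k} <Q,X> Q *)
Definition Pi_lt n (k : nat) (X : 'M[C]_(2 ^ n)) : 'M[C]_(2 ^ n) :=
  \sum_(Q : pauli n | (weight Q < k)%N) pcoef Q X *: pmx Q.

(* ||X||_{Pauli,1} := sum_Q |<Q,X>| *)
Definition pauli1norm n (X : 'M[C]_(2 ^ n)) : R :=
  \sum_(Q : pauli n) Normc.normc (pcoef Q X).

(* ---------- linear algebra on C-matrices ---------- *)
Definition adjmx m (A : 'M[C]_m) : 'M[C]_m := map_mx (fun z => z^*) A^T.

(* Hilbert–Schmidt adjoint of a (linear) map Phi on m x m matrices: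
   the map Phi^† with Tr(Y^* Phi(X)) = Tr(Phi^†(Y)^* X) for all X, Y;
   its (r,c) entry is <E_rc, Phi^†(Y)> = conj Tr(Y^* Phi(E_rc)). *)
Definition hs_adj m (Phi : 'M[C]_m -> 'M[C]_m) (Y : 'M[C]_m) : 'M[C]_m :=
  \matrix_(r, c) (\tr (adjmx Y *m Phi (delta_mx r c)))^*.

(* Matrix exponential exp(A) = sum_{k>=0} A^k / k!, defined entrywise as the limit
   (of real and imaginary parts) of the partial sums. *)
Definition expm_partial m (A : 'M[C]_m) (N : nat) : 'M[C]_m :=
  \sum_(k < N) (k`!%:R)^-1 *: A ^+ k.

Definition expm m (A : 'M[C]_m) : 'M[C]_m :=
  \matrix_(r, c) ((limn (fun N => complex.Re (expm_partial A N r c)))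
                   +i* (limn (fun N => complex.Im (expm_partial A N r c))))%C.

(* ---------- the Trotter-type construction of the statement ---------- *)
(* Terms a = 0, ..., M-1 (the ordering a_1, ..., a_M of T), coefficients lam a,
   Pauli strings Qs a.  Step j (1 <= j <= L) uses term a_j = (j-1) mod M. *)
Definition term_of (M j : nat) : nat := (j.-1 %% M)%N.

(* E_j := exp(delta * lam_{a_j} * Q_{a_j}) *)
Definition stepexp n (M : nat) (lam : nat -> R) (Qs : nat -> pauli n) (delta : R)
  (j : nat) : 'M[C]_(2 ^ n) :=
  expm (((delta * lam (term_of M j))%:C)%C *: pmx (Qs (term_of M j))).

(* M_j(X) := E_j X E_j *)
Definition Mstep (n M : nat) (lam : nat -> R) (Qs : nat -> pauli n) (delta : R) (j : nat) (X : 'M[C]_(2 ^ n)) : 'M[C]_(2 ^ n) :=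
  stepexp M lam Qs delta j *m X *m stepexp M lam Qs delta j.

(* A_j := M_j o ... o M_1 (I) *)
Fixpoint Aprop (n M : nat) (lam : nat -> R) (Qs : nat -> pauli n) (delta : R)
  (j : nat) : 'M[C]_(2 ^ n) :=
  match j with
  | 0 => 1%:M
  | j'.+1 => Mstep M lam Qs delta j'.+1 (@Aprop n M lam Qs delta j')
  end.

(* Obwd s = O_{L-s}: O_L := O, O_{j-1} := Pi_{<k}(M_j^†(O_j)). *)
Fixpoint Obwd (n M : nat) (lam : nat -> R) (Qs : nat -> pauli n) (delta : R) (L k : nat) (O : 'M[C]_(2 ^ n)) (s : nat)
  : 'M[C]_(2 ^ n) :=
  match s with
  | 0 => O
  | s'.+1 => Pi_lt k (hs_adj (Mstep M lam Qs delta (L - s')%N)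
                        (@Obwd n M lam Qs delta L k O s'))
  end.

End PauliDefs.

(* Main.v *)
(** Conjugation by [e^{c Q}] is controlled on Pauli coefficients because
    [e^{c Q} = cosh c I + sinh c Q]: left or right multiplication by it replaces the
    absolute coefficients [f] by at most [P |-> cosh c f(P) + |sinh c| f(P Q)].

    Iterating from the identity, [|<P, A_j>|] is at most the total weight of the
    subfamilies of the [2j] factors whose supports cover [supp P].  A covering family
    must contain a factor through a given point of [supp P], for which there are at most
    [2 (p+1) l] choices, and such a factor covers at most [w] points; repeating this
    [m = ceil(k/w)] times gives
    [|<P, A_j>| <= (2 (p+1) l sinh delta)^m e^{2 delta j}] whenever [|P| >= k].

    The error telescopes into the terms [Tr(Pi_{>=k}(M_j(O_j)) A_{j-1})].  For [j < L] the
    operator [O_j] has only weights [< k], so the truncated part has Pauli 1-norm at most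
    [sinh(2 delta) ||O_j||], while [||O_j|| <= e^{2 delta (L-j)} ||O||].  Summing, the
    error is at most [d G^m e^{2 delta L} (1 + 2 delta L) ||O||] with
    [G = 2 (p+1) l sinh delta <= g], and [1 + x <= e^x] concludes. *)
Require Import Defs.
From HB Require Import structures.
From mathcomp Require Import all_boot all_order all_algebra.
From mathcomp Require Import complex.
From mathcomp Require Import classical_sets boolp reals topology normedtype sequences exp.
From mathcomp Require Import ring lra zify.
Import Order.TTheory GRing.Theory Num.Theory.
Import numFieldNormedType.Exports.
Local Open Scope ring_scope.

Set Implicit Arguments.
Unset Strict Implicit.
Unset Printing Implicit Defensive.

(** * Basis indices as bit strings *)

Section Qubits.

(** A number is determined by its parity and its half, so induction peels off the lowest bit. *)
Lemma qbit_inj n (r c : nat) : (r < 2 ^ n)%N -> (c < 2 ^ n)%N ->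
  (forall j, (j < n)%N -> qbit r j = qbit c j) -> r = c.
Proof.
elim: n r c => [|n IH] r c.
  by rewrite expn0 !ltnS !leqn0 => /eqP -> /eqP ->.
rewrite expnS mulnC => hr hc h.
have hodd : odd r = odd c by have := h 0%N isT; rewrite /qbit expn0 !divn1.
have hhalf : (r %/ 2 = c %/ 2)%N.
  apply: IH; rewrite ?ltn_divLR // => j hj.
  by have := h j.+1 hj; rewrite /qbit expnS !divnMA.
by rewrite (divn_eq r 2) (divn_eq c 2) hhalf !modn2 hodd.
Qed.

Definition qbits n (r : 'I_(2 ^ n)) : {ffun 'I_n -> bool} := [ffun j => qbit r (val j)].

Lemma qbits_inj n : injective (@qbits n).
Proof.
move=> r c /ffunP h; apply/val_inj/(@qbit_inj n _ _ (ltn_ord r) (ltn_ord c)) => j hj.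
by have := h (Ordinal hj); rewrite !ffunE.
Qed.

Lemma qbits_bij n : bijective (@qbits n).
Proof.
apply: inj_card_bij; first exact: qbits_inj.
by rewrite card_ffun card_bool !card_ord.
Qed.

(** Basis indices biject with bit vectors, so the sum distributes; traces and products of Pauli
    strings thereby factor qubit by qubit. *)
Lemma sum_prod_qbit (A : comNzRingType) n (F : 'I_n -> bool -> A) :
  \sum_(r < 2 ^ n) \prod_(j < n) F j (qbit r j) = \prod_(j < n) \sum_b F j b.
Proof.
rewrite bigA_distr_bigA /= (reindex (@qbits n)) /=; last exact/onW_bij/qbits_bij.
by apply: eq_bigr => r _; apply: eq_bigr => j _; rewrite ffunE.
Qed.

Lemma prod_qbit_eq (A : comNzRingType) n (r c : 'I_(2 ^ n)) :
  \prod_(j < n) (qbit r j == qbit c j)%:R = (r == c)%:R :> A.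
Proof.
case: eqP => [->|ne]; first by rewrite big1 // => j _; rewrite eqxx.
have [/forallP h|] := boolP [forall j : 'I_n, qbit r j == qbit c j].
  case: ne; apply/val_inj/(@qbit_inj n _ _ (ltn_ord r) (ltn_ord c)) => j hj; exact/eqP/(h (Ordinal hj)).
rewrite negb_forall => /existsP [j /negbTE hj].
by rewrite (bigD1 j) //= hj mul0r.
Qed.

End Qubits.

(** * Algebra of Pauli strings and Pauli coefficients *)

Section PauliGroup.
Variable R : realType.
Local Notation C := R[i].
Implicit Types (a b : 'I_4).

(* Up to phase, the single-qubit Pauli matrices form the Klein four-group. *)
Definition pxor a b : 'I_4 :=
  match val a, val b with
  | 0, _ => b
  | _, 0 => a
  | 1, 2 | 2, 1 => inord 3
  | 1, 3 | 3, 1 => inord 2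
  | 2, 3 | 3, 2 => inord 1
  | _, _ => ord0
  end.

(** The sign of the imaginary unit follows the cyclic order X, Y, Z. *)
Definition phase1 a b : C :=
  match val a, val b with
  | 1, 2 | 2, 3 | 3, 1 => 'i%C
  | 2, 1 | 3, 2 | 1, 3 => - 'i%C
  | _, _ => 1
  end.

(** Cases written through [inord] let [inordK] settle the multiplication tables by computation. *)
Lemma ord4_ind (P : 'I_4 -> Prop) : P ord0 -> P (inord 1) -> P (inord 2) -> P (inord 3) ->
  forall a, P a.
Proof.
move=> p0 p1 p2 p3 a; rewrite -(inord_val a).
case: a => [[|[|[|[|//]]]] h] //=.
by have -> : inord 0 = ord0 :> 'I_4 by apply/val_inj; rewrite /= inordK.
Qed.

Lemma pxorC a b : pxor a b = pxor b a.
Proof.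
by elim/ord4_ind: a; elim/ord4_ind: b; rewrite /pxor /= ?inordK.
Qed.

Lemma pxorK a b : pxor (pxor a b) b = a.
Proof.
by apply/val_inj; elim/ord4_ind: a; elim/ord4_ind: b; rewrite /pxor /= ?inordK //= ?inordK.
Qed.

Lemma pxor0 a : pxor a ord0 = a.
Proof. by rewrite pxorC. Qed.

Lemma pxor_eq0 a b : (pxor a b == ord0) = (a == b).
Proof.
by rewrite -!val_eqE; elim/ord4_ind: a; elim/ord4_ind: b; rewrite /pxor /= ?inordK //= ?inordK.
Qed.

Lemma mulrii : 'i%C * 'i%C = -1 :> C.
Proof. by rewrite -expr2 sqr_i. Qed.

Lemma sigma_mul a b r c :
  \sum_x sigma R a r x * sigma R b x c = phase1 a b * sigma R (pxor a b) r c.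
Proof.
rewrite big_bool.
by elim/ord4_ind: a; elim/ord4_ind: b; case: r; case: c;
  rewrite /pxor /phase1 /sigma /= ?inordK //= ?inordK //=
  ?(mul0r, mulr0, mul1r, mulr1, addr0, add0r, mulrN, mulNr, mulrii, opprK, oppr0).
Qed.

Lemma normc_phase1 a b : Normc.normc (phase1 a b) = 1.
Proof.
have n1 := @Normc.normc1 R.
have ni : Normc.normc ('i%C : C) = 1.
  by rewrite /Normc.normc expr0n /= expr1n add0r sqrtr1.
by elim/ord4_ind: a; elim/ord4_ind: b; rewrite /phase1 /= ?inordK //= oppr0 sqrrN expr1n expr0n add0r sqrtr1.
Qed.

Lemma sigma_trace a : \sum_x sigma R a x x = 2 * (a == ord0)%:R.
Proof.
rewrite big_bool -val_eqE.
elim/ord4_ind: a; rewrite /sigma /= ?inordK //= ?mulr1 ?mulr0 ?addr0 //.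
by rewrite addrC subrr.
Qed.

(** Completeness relation: the tensor squares of the four matrices add up to twice the swap
    operator. *)
Lemma sigma_complete r c r' c' :
  \sum_a sigma R a r c * sigma R a r' c' = 2 * ((r == c')%:R * (c == r')%:R).
Proof.
rewrite !big_ord_recl big_ord0 /= /sigma /=.
by case: r; case: c; case: r'; case: c' => /=;
  rewrite ?(mul0r, mulr0, mul1r, mulr1, addr0, add0r, mulrN, mulNr, mulrii, opprK, oppr0) //; ring.
Qed.

Lemma sigma_conj a r c : (sigma R a r c)^* = sigma R a c r.
Proof.
by elim/ord4_ind: a; case: r; case: c; rewrite /sigma /= ?inordK //= ?rmorphN ?rmorph0 ?rmorph1 //;
  apply/eqP; rewrite eq_complex /= ?opprK ?oppr0 !eqxx.
Qed.

Variable n : nat.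
Implicit Types (P Q : pauli n) (X Y : 'M[C]_(2 ^ n)).

Definition pmul P Q : pauli n := [ffun j => pxor (P j) (Q j)].
Definition phase P Q : C := \prod_(j < n) phase1 (P j) (Q j).
Definition pid : pauli n := [ffun=> ord0].

Lemma pmulC P Q : pmul P Q = pmul Q P.
Proof. by apply/ffunP => j; rewrite !ffunE pxorC. Qed.

Lemma pmulK P Q : pmul (pmul P Q) Q = P.
Proof. by apply/ffunP => j; rewrite !ffunE pxorK. Qed.

Lemma pmul_inj Q : injective (pmul^~ Q).
Proof. exact: (@can_inj _ _ _ (pmul^~ Q) (fun P => pmulK P Q)). Qed.

Lemma pmul_eq_pid P Q : (pmul P Q == pid) = (P == Q).
Proof.
apply/eqP/eqP => [/ffunP h|->]; apply/ffunP => j.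
  by apply/eqP; rewrite -pxor_eq0; have := h j; rewrite !ffunE => ->.
by apply/eqP; rewrite !ffunE pxor_eq0.
Qed.

(** Qubits outside [supp Q] keep their factor. This links Pauli products to the set differences in
    [cover_weight]. *)
Lemma supp_pmul P Q : supp P :\: supp Q \subset supp (pmul P Q).
Proof.
apply/fintype.subsetP => j; rewrite !inE ffunE negbK => /andP[/eqP -> h].
by rewrite pxor0.
Qed.

Lemma normc_prod I (s : seq I) (F : I -> C) :
  Normc.normc (\prod_(i <- s) F i) = \prod_(i <- s) Normc.normc (F i).
Proof. exact: (big_morph _ (@Normc.normcM R) (@Normc.normc1 R)). Qed.

Lemma normc_phase P Q : Normc.normc (phase P Q) = 1.
Proof. by rewrite normc_prod big1 // => j _; exact: normc_phase1. Qed.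

Lemma pmx_mul P Q : pmx R P *m pmx R Q = phase P Q *: pmx R (pmul P Q).
Proof.
apply/matrixP => r c; rewrite !mxE.
under eq_bigr do rewrite !mxE -big_split.
rewrite (sum_prod_qbit (fun j x => sigma R (P j) (qbit r j) x * sigma R (Q j) x (qbit c j))).
by rewrite -big_split; apply: eq_bigr => j _; rewrite sigma_mul ffunE.
Qed.

Lemma pmx_id : pmx R pid = 1%:M.
Proof.
apply/matrixP => r c; rewrite !mxE -prod_qbit_eq.
apply: eq_bigr => j _; rewrite ffunE /sigma /=.
by case: eqP.
Qed.

Lemma pmx_sqr P : pmx R P *m pmx R P = 1%:M.
Proof.
rewrite pmx_mul (eqP (_ : pmul P P == pid)) ?pmul_eq_pid // pmx_id.
rewrite /phase big1 ?scale1r // => j _.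
by elim/ord4_ind: (P j); rewrite /phase1 /= ?inordK.
Qed.

Lemma dim_neq0 : Defs.dim R n != 0.
Proof. by rewrite /Defs.dim pnatr_eq0 -lt0n expn_gt0. Qed.

Lemma tr_pmx P : \tr (pmx R P) = Defs.dim R n * (P == pid)%:R.
Proof.
rewrite /mxtrace; under eq_bigr do rewrite mxE.
rewrite (sum_prod_qbit (fun j x => sigma R (P j) x x)).
under eq_bigr do rewrite sigma_trace.
rewrite big_split prodr_const card_ord /Defs.dim natrX /=; congr (_ * _).
case: eqP => [->|ne]; first by rewrite big1 // => j _; rewrite ffunE eqxx.
have [/forallP h|] := boolP [forall j, P j == ord0].
  by case: ne; apply/ffunP => j; rewrite ffunE; apply/eqP.
by rewrite negb_forall => /existsP [j /negbTE hj]; rewrite (bigD1 j) //= hj mul0r.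
Qed.

Lemma pcoef_pmx Q P : pcoef Q (pmx R P) = (Q == P)%:R.
Proof.
rewrite /pcoef pmx_mul linearZ /= tr_pmx pmul_eq_pid.
case: eqP => [->|_]; last by rewrite !mulr0.
rewrite mulr1 /phase big1 ?mul1r ?mulVf ?dim_neq0 // => j _.
by elim/ord4_ind: (P j); rewrite /phase1 /= ?inordK.
Qed.

Lemma pcoef_is_scalar Q : scalar (@pcoef R n Q).
Proof.
move=> x X Y; rewrite /pcoef mulmxDr -scalemxAr linearD linearZ /=.
by rewrite mulrDr mulrCA.
Qed.

HB.instance Definition _ Q := GRing.isLinear.Build C 'M[C]_(2 ^ n) C *%R (@pcoef R n Q) (pcoef_is_scalar Q).

(** Once the coefficients are expanded, the sum over [Q] factors over qubits; [sigma_complete] turns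
    it into Kronecker deltas that isolate the entry [X r c]. *)
Lemma pauli_expansion X : X = \sum_Q pcoef Q X *: pmx R Q.
Proof.
apply/matrixP => r c; rewrite summxE.
have E Q : (pcoef Q X *: pmx R Q) r c = (Defs.dim R n)^-1 *
    \sum_u \sum_v X v u * (pmx R Q u v * pmx R Q r c).
  rewrite mxE /pcoef -mulrA; congr (_ * _); rewrite /mxtrace mulr_suml.
  by apply: eq_bigr => u _; rewrite mxE mulr_suml; apply: eq_bigr => v _; ring.
rewrite (eq_bigr _ (fun Q _ => E Q)) -mulr_sumr exchange_big /=.
under eq_bigr => u _.
  rewrite exchange_big /=; under eq_bigr => v _.
    rewrite -mulr_sumr (_ : \sum_Q _ = Defs.dim R n * ((u == c)%:R * (v == r)%:R)).
      over.
    under eq_bigr do rewrite !mxE -big_split.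
    rewrite -(bigA_distr_bigA (fun (j : 'I_n) a => sigma R a (qbit u j) (qbit v j) * sigma R a (qbit r j) (qbit c j))).
    under eq_bigr do rewrite sigma_complete.
    by rewrite big_split prodr_const card_ord big_split !prod_qbit_eq /Defs.dim natrX.
  over.
rewrite (bigD1 c) //= (bigD1 r) //= !eqxx !mulr1 big1 => [|v /negbTE ->]; last by rewrite !mulr0.
rewrite big1 => [|u /negbTE ->]; last by rewrite big1 // => v _; rewrite !mul0r !mulr0.
by rewrite !addr0 mulrCA mulVf ?dim_neq0 ?mulr1.
Qed.

Lemma tr_mul_pcoef X Y : \tr (X *m Y) = Defs.dim R n * \sum_Q pcoef Q X * pcoef Q Y.
Proof.
rewrite {1}(pauli_expansion X) mulmx_suml linear_sum /= mulr_sumr.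
apply: eq_bigr => Q _; rewrite -scalemxAl linearZ /= mulrCA; congr (_ * _).
by rewrite /pcoef mulrA divff ?dim_neq0 // mul1r.
Qed.

Lemma pcoef_Pi_lt Q k X : pcoef Q (Pi_lt k X) = (weight Q < k)%:R * pcoef Q X.
Proof.
rewrite /Pi_lt linear_sum /=.
under eq_bigr do rewrite linearZ /= pcoef_pmx.
have [lt|ge] := ltnP (weight Q) k.
  rewrite (bigD1 Q) //= eqxx big1 => [|P /andP[_ /negbTE]]; first by rewrite addr0 mul1r mulr1.
  by rewrite eq_sym => ->; rewrite mulr0.
rewrite mul0r big1 // => P lt; case: eqP => [e|]; last by rewrite mulr0.
by move: lt; rewrite -e ltnNge ge.
Qed.

(** The phase has modulus one, so multiplication by a Pauli string merely permutes absolute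
    coefficients. *)
Lemma normc_pcoef_mull Q P X :
  Normc.normc (pcoef Q (pmx R P *m X)) = Normc.normc (pcoef (pmul Q P) X).
Proof.
rewrite /pcoef mulmxA pmx_mul -scalemxAl linearZ /= mulrCA Normc.normcM.
by rewrite normc_phase mul1r.
Qed.

Lemma normc_pcoef_mulr Q P X :
  Normc.normc (pcoef Q (X *m pmx R P)) = Normc.normc (pcoef (pmul Q P) X).
Proof.
rewrite /pcoef mulmxA mxtrace_mulC mulmxA pmx_mul -scalemxAl linearZ /= mulrCA Normc.normcM.
by rewrite normc_phase mul1r pmulC.
Qed.

Lemma adjmx_pmx P : adjmx (pmx R P) = pmx R P.
Proof.
apply/matrixP => r c; rewrite !mxE rmorph_prod.
by apply: eq_bigr => j _; exact: sigma_conj.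
Qed.

End PauliGroup.

(** * Hyperbolic functions *)

Section Hyperbolic.
Variable R : realType.
Implicit Types x y : R.

Definition cosh x : R := (expR x + expR (- x)) / 2.
Definition sinh x : R := (expR x - expR (- x)) / 2.

Lemma coshDsinh x : cosh x + sinh x = expR x.
Proof. by rewrite /cosh /sinh; field. Qed.

Lemma cosh_ge1 x : 1 <= cosh x.
Proof.
rewrite /cosh; have := expR_ge1Dx x; have := expR_ge1Dx (- x); lra.
Qed.

Lemma cosh_abs x : cosh `|x| = cosh x.
Proof. by case: (ger0P x) => // _; rewrite /cosh opprK addrC. Qed.

Lemma sinh_abs x : sinh `|x| = `|sinh x|.
Proof.
rewrite /sinh; case: (ger0P x) => hx.
  by rewrite ger0_norm // divr_ge0 // subr_ge0 ler_expR; lra.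
rewrite ler0_norm; first by rewrite opprK -mulNr opprB.
rewrite -oppr_ge0 -mulNr opprB divr_ge0 // subr_ge0 ler_expR; lra.
Qed.

Lemma sinh_ge0 x : 0 <= x -> 0 <= sinh x.
Proof. by move=> hx; rewrite divr_ge0 // subr_ge0 ler_expR; lra. Qed.

Lemma ler_sinh x y : x <= y -> sinh x <= sinh y.
Proof.
move=> xy; rewrite /sinh ler_wpM2r ?invr_ge0 ?ler0n // lerB // ler_expR; lra.
Qed.

Lemma ler_cosh x y : 0 <= x -> x <= y -> cosh x <= cosh y.
Proof.
move=> x0 xy; rewrite /cosh.
have h := expR_gt0 x; have h1 := expRxMexpNx_1 x; have h2 := expRxMexpNx_1 y.
have hxy : expR x <= expR y by rewrite ler_expR.
have h3 : 1 <= expR x by rewrite -expR0 ler_expR.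
move: h h1 h2 hxy h3; set a := expR x; set a' := expR (- x).
set b := expR y; set b' := expR (- y) => a0 aa bb ab a1.
rewrite ler_wpM2r ?invr_ge0 ?ler0n //.
have -> : a' = a^-1 by rewrite /a' expRN.
have -> : b' = b^-1 by rewrite /b' expRN.
have b0 : 0 < b by lra.
(* The difference b + 1/b - a - 1/a factors, and both factors are nonnegative because 1 <= a <=
   b. *)
rewrite -subr_ge0 (_ : _ - _ = (b - a) * (1 - (a * b)^-1)); last first.
  by field; rewrite !gt_eqF.
rewrite mulr_ge0 ?subr_ge0 // invf_le1 ?mulr_gt0 //; nra.
Qed.

(** Factor out e^x and use 1 - 2x <= e^(-2x). *)
Lemma sinh_le x : sinh x <= x * expR x.
Proof.
rewrite /sinh; have h := expR_gt0 x; have h1 := expR_ge1Dx (- (2 * x)).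
have -> : expR (- x) = expR x * expR (- (2 * x)) by rewrite -expRD; congr expR; ring.
nra.
Qed.

Lemma sinh2 x : sinh (2 * x) = 2 * cosh x * sinh x.
Proof.
by rewrite (_ : 2 * x = x + x) 1?/sinh 1?/cosh ?opprD ?expRD; [field|ring].
Qed.

End Hyperbolic.

(** * Exponential of an involution *)

Section ExpInvolution.
Local Open Scope classical_set_scope.
Local Open Scope ring_scope.
Variable R : realType.
Local Notation C := R[i].

(** Even powers of [A] are the identity and odd ones are [A]; the half-sum and half-difference of
    the scalar series at [c] and [- c] collect the two parities. *)
Lemma expm_partial_involution m (A : 'M[C]_m) (c : R) N : A *m A = 1%:M ->
  expm_partial ((c%:C)%C *: A) N =
    (((series (exp_coeff c) N + series (exp_coeff (- c)) N) / 2)%:C)%C *: 1%:M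
  + (((series (exp_coeff c) N - series (exp_coeff (- c)) N) / 2)%:C)%C *: A.
Proof.
move=> A2; rewrite /expm_partial /series /=.
elim: N => [|N IH].
  by rewrite big_ord0 !big_geq // subrr addr0 !mul0r !scale0r addr0.
rewrite big_ord_recr /= IH !big_nat_recr //=.
have AN : A ^+ N = (((1 + (-1) ^+ N) / 2)%:C)%C *: 1%:M + (((1 - (-1) ^+ N) / 2)%:C)%C *: A.
  elim: N {IH} => [|N IHN].
    rewrite !expr0 subrr mul0r scale0r addr0.
    by rewrite (_ : (1 + 1) / 2 = 1 :> R) ?scale1r //; field.
  rewrite exprS IHN -mulmxE mulmxDr -!scalemxAr A2 mulmx1 addrC exprS.
  by congr (_ *: _ + _ *: _); congr (_%:C)%C; rewrite mulN1r ?opprK.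
have -> : ((c%:C)%C *: A) ^+ N = ((c ^+ N)%:C)%C *: A ^+ N.
  elim: N {IH AN} => [|N IHN]; first by rewrite !expr0 scale1r.
  rewrite !exprS IHN -!mulmxE -scalemxAl -scalemxAr scalerA.
  by congr (_ *: _); rewrite -rmorphM.
rewrite AN !scalerDr !scalerA addrACA -!scalerDl.
have -> : (N`!%:R)^-1 = ((N`!%:R)^-1)%:C%C :> C by rewrite fmorphV /= rmorph_nat.
have e1 : (- c) ^+ N = (-1) ^+ N * c ^+ N by exact: exprNn.
rewrite -!(rmorphM (real_complex R)) -!(rmorphD (real_complex R)) /=.
by congr (_ *: _ + _ *: _); congr (_%:C)%C; rewrite /exp_coeff /= e1; field;
  rewrite pnatr_eq0 -lt0n fact_gt0.
Qed.

(** Both coefficients are real, so they pass through real and imaginary parts, and the entrywise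
    limits reduce to the scalar exponential series. *)
Lemma expm_involution m (A : 'M[C]_m) (c : R) : A *m A = 1%:M ->
  expm ((c%:C)%C *: A) = ((cosh c)%:C)%C *: 1%:M + ((sinh c)%:C)%C *: A.
Proof.
move=> A2; apply/matrixP => r s; rewrite mxE.
have cvgE (x : R) : series (exp_coeff x) @ \oo --> expR x by exact: is_cvg_series_exp_coeff.
have cc : (fun N => (series (exp_coeff c) N + series (exp_coeff (- c)) N) / 2) @ \oo --> cosh c.
  by apply: cvgMr_tmp; apply: cvgD; exact: cvgE.
have cs : (fun N => (series (exp_coeff c) N - series (exp_coeff (- c)) N) / 2) @ \oo --> sinh c.
  by apply: cvgMr_tmp; apply: cvgB; exact: cvgE.
have reZ (x : R) (z : C) : complex.Re ((x%:C)%C * z) = x * complex.Re z.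
  by case: z => a b /=; rewrite mul0r subr0.
have imZ (x : R) (z : C) : complex.Im ((x%:C)%C * z) = x * complex.Im z.
  by case: z => a b /=; rewrite mul0r addr0.
rewrite (_ : limn _ = cosh c * complex.Re ((1%:M : 'M[C]_m) r s) + sinh c * complex.Re (A r s)); last first.
  apply/cvg_lim => //.
  rewrite (_ : (fun _ => _) = fun N =>
    (series (exp_coeff c) N + series (exp_coeff (- c)) N) / 2 * complex.Re ((1%:M : 'M[C]_m) r s)
    + (series (exp_coeff c) N - series (exp_coeff (- c)) N) / 2 * complex.Re (A r s)).
    by apply: cvgD; apply: cvgMr_tmp.
  by apply/funext => N; rewrite expm_partial_involution // !mxE raddfD /= -!reZ.
rewrite (_ : limn _ = cosh c * complex.Im ((1%:M : 'M[C]_m) r s) + sinh c * complex.Im (A r s)); last first.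
  apply/cvg_lim => //.
  rewrite (_ : (fun _ => _) = fun N =>
    (series (exp_coeff c) N + series (exp_coeff (- c)) N) / 2 * complex.Im ((1%:M : 'M[C]_m) r s)
    + (series (exp_coeff c) N - series (exp_coeff (- c)) N) / 2 * complex.Im (A r s)).
    by apply: cvgD; apply: cvgMr_tmp.
  by apply/funext => N; rewrite expm_partial_involution // !mxE raddfD /= -!imZ.
rewrite !mxE -!reZ -!imZ -!raddfD /=.
by case: (_ + _).
Qed.

End ExpInvolution.

(** * Weighted set covers *)

Section Cover.
Variables (R : realFieldType) (T : finType) (ch sh : R).
Hypotheses (ch_ge1 : 1 <= ch) (sh_ge0 : 0 <= sh).
Implicit Types (U V t : {set T}) (s : seq {set T}).

(* Total weight of the subfamilies of [s] covering [U], where a selected member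
   has weight [sh] and a rejected one weight [ch]. *)
Fixpoint cover_weight s U : R :=
  if s is t :: s' then ch * cover_weight s' U + sh * cover_weight s' (U :\: t)
  else (U == finset.set0)%:R.

Let ch_ge0 : 0 <= ch. Proof. exact: le_trans ler01 ch_ge1. Qed.

Lemma cover_weight_ge0 s U : 0 <= cover_weight s U.
Proof. by elim: s U => [|t s IH] U //=; rewrite addr_ge0 ?mulr_ge0. Qed.

Lemma cover_weight_anti s U V : U \subset V -> cover_weight s V <= cover_weight s U.
Proof.
elim: s U V => [|t s IH] U V sUV /=.
  case: (V =P finset.set0) sUV => [->|_ _]; last exact: ler0n.
  by rewrite finset.subset0 => ->.
by rewrite lerD ?ler_wpM2l ?IH // finset.setSD.
Qed.

(** The right-hand side is the total weight of all subfamilies, covering or not. *)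
Lemma cover_weight_le s U : cover_weight s U <= (ch + sh) ^+ size s.
Proof.
elim: s U => [|t s IH] U /=; first by rewrite expr0 lern1 leq_b1.
by rewrite exprS mulrDl lerD ?ler_wpM2l.
Qed.

(* A covering subfamily has to select a member containing the point [i]. *)
Lemma cover_weight_pick s U i : i \in U ->
  cover_weight s U <= sh * \sum_(t <- s | i \in t) cover_weight s (U :\: t).
Proof.
elim: s U => [|t s IH] U iU /=.
  rewrite big_nil mulr0; case: eqP => // e; by rewrite e inE in iU.
have tail V : i \in V -> ch * cover_weight s V <=
    sh * \sum_(t' <- s | i \in t') ch * cover_weight s (V :\: t').
  by move=> iV; rewrite -mulr_sumr mulrCA ler_wpM2l ?IH.
rewrite big_cons; case: ifP => it.
  (* When [t] contains [i], the summand of [t] is [ch + sh] times the weight left after selecting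
     [t], which pays for that branch; the other summands pay for rejecting [t]. *)
  rewrite mulrDr addrC lerD //.
    rewrite ler_wpM2l // finset.setDDl finset.setUid -mulrDl.
    by rewrite ler_peMl ?cover_weight_ge0 // (le_trans ch_ge1) // lerDl.
  apply: (le_trans (tail U iU)); rewrite ler_wpM2l // ler_sum // => t' _.
  by rewrite lerDl mulr_ge0 ?cover_weight_ge0.
(* When [t] misses [i], the point stays uncovered in both branches, and the induction hypothesis
   serves each. *)
rewrite big_split mulrDr lerD ?tail //= ler_wpM2l //.
apply: (le_trans (IH (U :\: t) _)); first by rewrite inE it iU.
rewrite -mulr_sumr ler_wpM2l // ler_sum // => t' _.
by rewrite !finset.setDDl finset.setUC.
Qed.

(** Apply [cover_weight_pick] [m] times: each round gains [sh], has at most [N] choices and removes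
    at most [w] points, so a point remains before every round. *)
Lemma cover_weight_bound s U (w N m : nat) :
  (forall t, t \in s -> (#|t| <= w)%N) ->
  (forall i, (count (fun t : {set T} => i \in t) s <= N)%N) ->
  (m.-1 * w < #|U|)%N ->
  cover_weight s U <= (N%:R * sh) ^+ m * (ch + sh) ^+ size s.
Proof.
move=> hw hN; elim: m U => [|m IH] U hU.
  by rewrite expr0 mul1r cover_weight_le.
have /card_gt0P [i iU] : (0 < #|U|)%N by exact: leq_ltn_trans hU.
apply: (le_trans (cover_weight_pick s iU)).
rewrite exprS -[leRHS]mulrA; set B := (_ ^+ m * _).
have B0 : 0 <= B.
  by rewrite mulr_ge0 // exprn_ge0 ?mulr_ge0 ?addr_ge0.
apply: (@le_trans _ _ (sh * \sum_(t <- s | i \in t) B)).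
  rewrite ler_wpM2l // big_seq_cond [leRHS]big_seq_cond ler_sum // => t /andP[ts it].
  (* After the last round nothing may be left to cover, while [IH] at zero still asks for a nonempty
     set; the total weight bound replaces it. *)
  case: m hU IH @B B0 => [|m] hU IH B B0.
    by rewrite /B expr0 mul1r cover_weight_le.
  apply: IH => /=.
  have := finset.cardsID t U; have := hw t ts.
  have := subset_leq_card (finset.subsetIr U t).
  move: hU; rewrite /= mulSn; lia.
rewrite big_const_seq iter_addr_0.
by rewrite -[B *+ _]mulr_natl mulrCA -[leRHS]mulrA ler_wpM2r ?ler_nat ?(mulr_ge0 sh_ge0 B0).
Qed.

End Cover.

(** * Modulus of complex numbers *)

Section NormC.
Variable R : realType.

Lemma normc_real (x : R) : Normc.normc (x%:C)%C = `|x|.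
Proof. by rewrite /Normc.normc /= expr0n addr0 sqrtr_sqr. Qed.

Lemma normc_realM (x : R) (z : R[i]) : Normc.normc ((x%:C)%C * z) = `|x| * Normc.normc z.
Proof. by rewrite Normc.normcM normc_real. Qed.

Lemma normc_ge0 (z : R[i]) : 0 <= Normc.normc z.
Proof. by case: z => a b; exact: sqrtr_ge0. Qed.

Lemma ler_normc_sum I (s : seq I) (P : pred I) (F : I -> R[i]) :
  Normc.normc (\sum_(i <- s | P i) F i) <= \sum_(i <- s | P i) Normc.normc (F i).
Proof.
elim/big_rec2: _ => [|i x y _ le]; first by rewrite Normc.normc0.
by apply: (le_trans (le_normcD _ _)); rewrite lerD2l.
Qed.

End NormC.

(** * Effect of Pauli exponentials and truncation on coefficients *)

Section PauliWeights.
Variables (R : realType) (n : nat).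
Local Notation C := R[i].
Implicit Types (P Q : pauli n) (X Y A : 'M[C]_(2 ^ n)) (c delta : R).

(** Closed form of the exponential of [c] times [P], justified by [expm_involution]. *)
Definition pexp c P : 'M[C]_(2 ^ n) :=
  ((cosh c)%:C)%C *: 1%:M + ((sinh c)%:C)%C *: pmx R P.

Lemma adjmx_pexp c P : adjmx (pexp c P) = pexp c P.
Proof.
apply/matrixP => r s; rewrite /pexp.
have : (pmx R P s r)^* = pmx R P r s by rewrite -[in RHS]adjmx_pmx !mxE.
move: (pmx R P) => B e; rewrite !mxE rmorphD !rmorphM /= e.
have cr (x : R) : ((x%:C)%C : C)^* = (x%:C)%C.
  by apply/eqP; rewrite eq_complex /= oppr0 !eqxx.
by rewrite !cr conjC_nat eq_sym.
Qed.

(** By cyclicity, pairing with a matrix unit reads off an entry of E Y^* E, whose adjoint is E Y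
    E. *)
Lemma hs_adj_conj m (E Y : 'M[C]_m) : adjmx E = E ->
  hs_adj (fun Z => E *m Z *m E) Y = E *m Y *m E.
Proof.
move=> hE; apply/matrixP => r c; rewrite mxE.
rewrite mulmxA mxtrace_mulC !mulmxA.
rewrite /mxtrace.
have -> : \sum_i (E *m adjmx Y *m E *m delta_mx r c) i i = (E *m adjmx Y *m E) c r.
  rewrite (bigD1 c) //= big1 => [|i ne].
    rewrite addr0 !mxE (bigD1 r) //= big1 => [|j ne].
      by rewrite !mxE !eqxx mulr1 addr0.
    by rewrite !mxE (negbTE ne) mulr0.
  by rewrite mxE big1 // => j _; rewrite !mxE (negbTE ne) andbF mulr0.
have -> : (E *m Y *m E) r c = (adjmx (E *m adjmx Y *m E) r c).
  suff -> : adjmx (E *m adjmx Y *m E) = E *m Y *m E by [].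
  have adjM (U V : 'M[C]_m) : adjmx (U *m V) = adjmx V *m adjmx U.
    by rewrite /adjmx trmx_mul map_mxM.
  rewrite !adjM hE mulmxA; congr (_ *m _ *m _).
  by apply/matrixP => i j; rewrite !mxE conjCK.
by rewrite !mxE.
Qed.

Local Notation f X Q := (Normc.normc (pcoef Q X)).

Lemma pcoef_pexp_mull c delta P Q X : `|c| <= delta ->
  f (pexp c P *m X) Q <= cosh delta * f X Q + sinh delta * f X (pmul Q P).
Proof.
move=> hc; rewrite /pexp mulmxDl -!scalemxAl mul1mx linearD !linearZ /=.
apply: (le_trans (le_normcD _ _)).
rewrite !normc_realM normc_pcoef_mull -sinh_abs.
rewrite lerD // ler_wpM2r ?normc_ge0 ?ler_sinh //.
by rewrite ger0_norm -?(cosh_abs c) ?ler_cosh // (le_trans ler01) ?cosh_ge1.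
Qed.

Lemma pcoef_pexp_mulr c delta P Q X : `|c| <= delta ->
  f (X *m pexp c P) Q <= cosh delta * f X Q + sinh delta * f X (pmul Q P).
Proof.
move=> hc; rewrite /pexp mulmxDr -!scalemxAr mulmx1 linearD !linearZ /=.
apply: (le_trans (le_normcD _ _)).
rewrite !normc_realM normc_pcoef_mulr -sinh_abs.
rewrite lerD // ler_wpM2r ?normc_ge0 ?ler_sinh //.
by rewrite ger0_norm -?(cosh_abs c) ?ler_cosh // (le_trans ler01) ?cosh_ge1.
Qed.

(** Multiplying by [P] on both sides returns to [Q], giving the squares; one-sided multiplication
    occurs twice, giving 2 cosh sinh. *)
Lemma pcoef_pexp_conj c delta P Q X : `|c| <= delta ->
  f (pexp c P *m X *m pexp c P) Q <=
    (cosh delta ^+ 2 + sinh delta ^+ 2) * f X Q + sinh (2 * delta) * f X (pmul Q P).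
Proof.
move=> hc; apply: (le_trans (pcoef_pexp_mulr _ _ _ hc)).
have c0 := cosh_ge1 delta.
have s0 : 0 <= sinh delta by rewrite sinh_ge0 // (le_trans _ hc).
have h1 := pcoef_pexp_mull P Q X hc.
have := pcoef_pexp_mull P (pmul Q P) X hc; rewrite pmulK => h2.
rewrite sinh2.
move: h1 h2 c0 s0; set a := f X Q; set b := f X (pmul Q P); set ch := cosh _; set sh := sinh _.
set u := f _ _; set v := f _ _ => h1 h2 c0 s0.
have : ch * u <= ch * (ch * a + sh * b) by rewrite ler_wpM2l //; lra.
have : sh * v <= sh * (ch * b + sh * a) by rewrite ler_wpM2l.
rewrite !mulrDr !expr2; lra.
Qed.

(** The Pauli 1-norm of what [Pi_lt k] discards. *)
Definition high1norm k X : R := \sum_(Q : pauli n | (k <= weight Q)%N) f X Q.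

Lemma high1norm_le k X : high1norm k X <= pauli1norm X.
Proof.
rewrite /high1norm /pauli1norm [leRHS](bigID (fun Q => (k <= weight Q)%N)) /= lerDl.
by rewrite sumr_ge0 // => Q _; exact: normc_ge0.
Qed.

Lemma pauli1norm_ge0 X : 0 <= pauli1norm X.
Proof. by rewrite sumr_ge0 // => Q _; exact: normc_ge0. Qed.

Lemma pauli1norm_pmul P X : \sum_Q f X (pmul Q P) = pauli1norm X.
Proof. by rewrite /pauli1norm [RHS](reindex_inj (@pmul_inj _ P)). Qed.

(** Multiplication by [P] reindexes the sum, so the two factors add up to (cosh + sinh)^2. *)
Lemma pauli1norm_pexp_conj c delta P X : `|c| <= delta ->
  pauli1norm (pexp c P *m X *m pexp c P) <= expR delta ^+ 2 * pauli1norm X.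
Proof.
move=> hc.
apply: (@le_trans _ _ (\sum_Q ((cosh delta ^+ 2 + sinh delta ^+ 2) * f X Q
    + sinh (2 * delta) * f X (pmul Q P)))).
  by apply: ler_sum => Q _; exact: pcoef_pexp_conj.
rewrite big_split -!mulr_sumr /= pauli1norm_pmul -mulrDl -coshDsinh sinh2.
by rewrite le_eqVlt; apply/orP; left; apply/eqP; rewrite /pauli1norm; ring.
Qed.

(* Only the part of the conjugation that multiplies by [P] can raise the weight. *)
Lemma high1norm_pexp_conj k c delta P X : `|c| <= delta ->
  (forall Q, (k <= weight Q)%N -> pcoef Q X = 0) ->
  high1norm k (pexp c P *m X *m pexp c P) <= sinh (2 * delta) * pauli1norm X.
Proof.
move=> hc low; have d0 : 0 <= delta by exact: le_trans hc.
rewrite -(pauli1norm_pmul P X) mulr_sumr [leRHS](bigID (fun Q => (k <= weight Q)%N)) /=.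
rewrite -[leLHS]addr0 lerD //; last first.
  by rewrite sumr_ge0 // => Q _; rewrite mulr_ge0 ?normc_ge0 ?sinh_ge0 ?mulr_ge0.
apply: ler_sum => Q hQ; apply: (le_trans (pcoef_pexp_conj _ _ _ hc)).
by rewrite low // Normc.normc0 mulr0 add0r.
Qed.

Lemma pauli1norm_Pi_lt k X : pauli1norm (Pi_lt k X) <= pauli1norm X.
Proof.
apply: ler_sum => Q _; rewrite pcoef_Pi_lt; case: (_ < _)%N; rewrite ?mul1r //.
by rewrite mul0r Normc.normc0 normc_ge0.
Qed.

(** By [tr_mul_pcoef] the traces differ only in coefficients of weight at least [k], where those of
    [A] are at most [B]. *)
Lemma truncation_error k X A (B : R) :
  (forall Q, (k <= weight Q)%N -> f A Q <= B) ->
  Normc.normc (\tr (Pi_lt k X *m A) - \tr (X *m A)) <= (2 ^ n)%:R * (B * high1norm k X).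
Proof.
move=> hB; rewrite !tr_mul_pcoef -mulrBr -sumrB Normc.normcM.
have -> : Normc.normc (Defs.dim R n) = (2 ^ n)%:R.
  rewrite /Defs.dim (_ : _%:R = ((2 ^ n)%:R : R)%:C%C); last by rewrite rmorph_nat.
  by rewrite normc_real ger0_norm.
rewrite ler_wpM2l //; apply: (le_trans (ler_normc_sum _ _ _)).
rewrite (bigID (fun Q => (k <= weight Q)%N)) /= [X in _ + X]big1 ?addr0 => [|Q]; last first.
  by rewrite -ltnNge pcoef_Pi_lt => ->; rewrite mul1r subrr Normc.normc0.
rewrite mulr_sumr; apply: ler_sum => Q hQ.
rewrite pcoef_Pi_lt ltnNge hQ mul0r mul0r sub0r normcN Normc.normcM mulrC.
by rewrite ler_wpM2r ?normc_ge0 ?hB.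
Qed.

(** The cosh term rejects [supp P] and the sinh term selects it; [supp_pmul] with
    [cover_weight_anti] handles the latter. *)
Lemma pcoef_cover_mull c delta P X (s : seq {set 'I_n}) : `|c| <= delta ->
  (forall Q, f X Q <= cover_weight (cosh delta) (sinh delta) s (supp Q)) ->
  forall Q, f (pexp c P *m X) Q <=
    cover_weight (cosh delta) (sinh delta) (supp P :: s) (supp Q).
Proof.
move=> hc h Q; apply: (le_trans (pcoef_pexp_mull _ _ _ hc)) => /=.
have s0 : 0 <= sinh delta by rewrite sinh_ge0 // (le_trans _ hc).
have c1 := cosh_ge1 delta.
rewrite lerD ?ler_wpM2l ?h // ?(le_trans ler01 c1) //.
apply: (le_trans (h _)); apply: cover_weight_anti => //; exact: supp_pmul.
Qed.

Lemma pcoef_cover_mulr c delta P X (s : seq {set 'I_n}) : `|c| <= delta ->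
  (forall Q, f X Q <= cover_weight (cosh delta) (sinh delta) s (supp Q)) ->
  forall Q, f (X *m pexp c P) Q <=
    cover_weight (cosh delta) (sinh delta) (supp P :: s) (supp Q).
Proof.
move=> hc h Q; apply: (le_trans (pcoef_pexp_mulr _ _ _ hc)) => /=.
have s0 : 0 <= sinh delta by rewrite sinh_ge0 // (le_trans _ hc).
have c1 := cosh_ge1 delta.
rewrite lerD ?ler_wpM2l ?h // ?(le_trans ler01 c1) //.
apply: (le_trans (h _)); apply: cover_weight_anti => //; exact: supp_pmul.
Qed.

End PauliWeights.

(** * Forward and backward propagation *)

Section Trotter.
Variables (R : realType) (n M : nat) (lam : nat -> R) (Qs : nat -> pauli n) (delta : R).
Hypotheses (M_gt0 : (0 < M)%N) (delta_gt0 : 0 < delta).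
Hypothesis lam_le1 : forall a, (a < M)%N -> `|lam a| <= 1.
Local Notation C := R[i].
Local Notation Mst := (Mstep M lam Qs delta).
Local Notation Apr := (Aprop M lam Qs delta).
Implicit Types X O A : 'M[C]_(2 ^ n).

Let term_lt j : (term_of M j < M)%N. Proof. exact: ltn_pmod. Qed.

Let coef_le j : `|delta * lam (term_of M j)| <= delta.
Proof.
rewrite normrM (gtr0_norm delta_gt0) ler_piMr ?lam_le1 //; exact: ltW.
Qed.

Lemma stepexpE j :
  stepexp M lam Qs delta j = pexp (delta * lam (term_of M j)) (Qs (term_of M j)).
Proof. by rewrite /stepexp expm_involution // pmx_sqr. Qed.

Lemma hs_adj_Mstep j X : hs_adj (Mst j) X = Mst j X.
Proof. by apply: hs_adj_conj; rewrite stepexpE adjmx_pexp. Qed.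

Lemma tr_Mstep j X A : \tr (X *m Mst j A) = \tr (Mst j X *m A).
Proof. by rewrite /Mstep !mulmxA mxtrace_mulC !mulmxA. Qed.

(** Each support enters twice because a step multiplies on both sides. *)
Fixpoint slots j : seq {set 'I_n} :=
  if j is j'.+1 then
    let t := supp (Qs (term_of M j)) in t :: t :: slots j'
  else [::].

Lemma size_slots j : size (slots j) = j.*2.
Proof. by elim: j => //= j ->. Qed.

Lemma mem_slots j t : t \in slots j -> exists2 a, (a < M)%N & t = supp (Qs a).
Proof.
elim: j => //= j IH; rewrite !inE orbA orbb => /orP[/eqP ->|/IH //].
by exists (term_of M j.+1).
Qed.

Lemma count_slots j i : count (fun t : {set 'I_n} => i \in t) (slots j) =
  (\sum_(0 <= a < j) (i \in supp (Qs (a %% M))))%N.*2.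
Proof.
elim: j => [|j IH]; first by rewrite big_geq.
by rewrite big_nat_recr //= IH /term_of /= doubleD -addnn; lia.
Qed.

(** Extend [j] to [p] full periods; each period meets [i] at most [l] times, doubled by the two
    sides. *)
Lemma count_slots_le p l j i :
  (#|[set a : 'I_M | i \in supp (Qs a)]| <= l)%N -> (j <= p * M)%N ->
  (count (fun t : {set 'I_n} => i \in t) (slots j) <= (p * l).*2)%N.
Proof.
move=> hl hj; rewrite count_slots leq_double.
apply: (@leq_trans (\sum_(0 <= a < p * M) (i \in supp (Qs (a %% M))))%N).
  by rewrite [leqRHS](@big_cat_nat _ _ _ j) //= leq_addr.
elim: p {hj} => [|p IH]; first by rewrite mul0n big_geq.
rewrite !mulSn (@big_cat_nat _ _ _ M) ?leq_addr //= leq_add //.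
  apply: leq_trans hl; rewrite big_mkord -sum1_card big_mkcond /=.
  rewrite [leqRHS]big_mkcond /=.
  apply: leq_sum => a _; rewrite modn_small ?ltn_ord //.
  have -> : (a \in [set a : 'I_M | i \in supp (Qs a)]) = (i \in supp (Qs a)) by rewrite finset.in_set.
  by case: (_ \in _).
rewrite -[X in index_iota X _]add0n big_addn addKn; apply: leq_trans IH.
by apply: leq_sum => a _; rewrite modnDr.
Qed.

Lemma pcoef_Aprop_cover j Q :
  Normc.normc (pcoef Q (Apr j)) <= cover_weight (cosh delta) (sinh delta) (slots j) (supp Q).
Proof.
elim: j Q => [|j IH] Q.
  rewrite /= -(pmx_id R) pcoef_pmx; case: eqP => [->|_]; last by rewrite Normc.normc0 ler0n.
  rewrite Normc.normc1 (_ : supp _ = finset.set0) ?eqxx //.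
  by apply/setP => i; rewrite !inE ffunE eqxx.
rewrite -[Apr _]/(Mst j.+1 (Apr j)) /Mstep stepexpE.
apply: (@pcoef_cover_mulr _ _ _ _ _ _ (supp _ :: slots j)) => // Q'.
exact: pcoef_cover_mull.
Qed.

Lemma pcoef_Aprop_le p l w m j Q :
  (forall a, (a < M)%N -> (weight (Qs a) <= w)%N) ->
  (forall i : 'I_n, (#|[set a : 'I_M | i \in supp (Qs a)]| <= l)%N) ->
  (j <= p * M)%N -> (m.-1 * w < weight Q)%N ->
  Normc.normc (pcoef Q (Apr j)) <= ((p * l).*2%:R * sinh delta) ^+ m * expR delta ^+ j.*2.
Proof.
move=> hw hl hj hQ; apply: (le_trans (pcoef_Aprop_cover j Q)).
rewrite -(size_slots j) -coshDsinh; apply: cover_weight_bound hQ.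
- exact: cosh_ge1.
- by rewrite sinh_ge0 // ltW.
- by move=> t /mem_slots[a ha ->]; exact: hw.
- by move=> i; apply: count_slots_le hj.
Qed.

Lemma pauli1norm_Mstep j X : pauli1norm (Mst j X) <= expR delta ^+ 2 * pauli1norm X.
Proof. by rewrite /Mstep stepexpE; exact: pauli1norm_pexp_conj. Qed.

Lemma pauli1norm_Obwd L k O s :
  pauli1norm (Obwd M lam Qs delta L k O s) <= expR delta ^+ s.*2 * pauli1norm O.
Proof.
elim: s => [|s IH]; first by rewrite expr0 mul1r.
rewrite /= hs_adj_Mstep; apply: (le_trans (pauli1norm_Pi_lt _ _)).
apply: (le_trans (pauli1norm_Mstep _ _)).
by rewrite doubleS -(add2n s.*2) exprD -mulrA ler_wpM2l // exprn_ge0 // expR_ge0.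
Qed.

(** Telescoping over backward steps. The summand 1 pays for the first truncation, where [O] may
    already have high weight; each later one costs 2 delta. *)
Lemma backward_error L k (B : R) O s : 0 <= B ->
  (forall j Q, (j <= L)%N -> (k <= weight Q)%N ->
     Normc.normc (pcoef Q (Apr j)) <= B * expR delta ^+ j.*2) ->
  (s <= L)%N ->
  Normc.normc (\tr (Obwd M lam Qs delta L k O s *m Apr (L - s)) - \tr (O *m Apr L))
  <= (2 ^ n)%:R * (B * expR delta ^+ L.*2 * pauli1norm O * (1 + 2 * delta * s%:R)).
Proof.
move=> B0 hB; set q := expR delta; have q0 : 0 <= q by exact: expR_ge0.
have N0 := pauli1norm_ge0 O.
have D0 : 0 <= delta by exact: ltW.
elim: s => [|s IH] hs.
  rewrite subn0 subrr Normc.normc0 mulr0 addr0 mulr1.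
  by rewrite !mulr_ge0 // exprn_ge0.
have Es : (L - s = (L - s.+1).+1)%N by lia.
set X := Obwd M lam Qs delta L k O s.
(* Moving a step across the trace is exact, so only the projection contributes an error. *)
have step : Normc.normc (\tr (Obwd M lam Qs delta L k O s.+1 *m Apr (L - s.+1))
      - \tr (X *m Apr (L - s))) <=
    (2 ^ n)%:R * (B * q ^+ (L - s.+1).*2 * high1norm k (Mst (L - s) X)).
  rewrite [in \tr (X *m _)]Es /= -Es tr_Mstep hs_adj_Mstep.
  by apply: truncation_error => Q hQ; apply: hB => //; lia.
have qL : q ^+ L.*2 = q ^+ (L - s.+1).*2 * q ^+ 2 * q ^+ s.*2.
  by rewrite -!exprD; congr (_ ^+ _); lia.
have d0 : 0 <= (2 ^ n)%:R :> R by exact: ler0n.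
have C0 : 0 <= B * q ^+ (L - s.+1).*2 by rewrite mulr_ge0 ?exprn_ge0.
(* For the first backward step [X] is [O] itself, so its high part is bounded by the full norm. *)
case: s IH hs Es @X step qL C0 => [|s] IH hs Es X step qL C0.
  move: step; rewrite /X subn0 => step; apply: (le_trans step).
  rewrite ler_wpM2l // qL expr0 mulr1.
  apply: (@le_trans _ _ (B * q ^+ (L - 1).*2 * (q ^+ 2 * pauli1norm O))).
    rewrite ler_wpM2l //; apply: (le_trans (high1norm_le _ _)).
    exact: pauli1norm_Mstep.
  rewrite [leRHS](_ : _ = B * q ^+ (L - 1).*2 * (q ^+ 2 * (pauli1norm O * (1 + 2 * delta)))).
    apply: (ler_wpM2l C0); apply: ler_wpM2l; rewrite ?exprn_ge0 //.
    by rewrite ler_peMr // lerDl mulr_ge0.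
  ring.
have low Q : (k <= weight Q)%N -> pcoef Q X = 0.
  by move=> hQ; rewrite /X /= pcoef_Pi_lt ltnNge hQ mul0r.
(* Here [X] is already truncated, so the discarded part carries the small factor sinh(2 delta) <= 2
   delta e^(2 delta). *)
have inc : high1norm k (Mst (L - s.+1) X) <= 2 * delta * q ^+ 2 * (q ^+ s.+1.*2 * pauli1norm O).
  rewrite /Mstep stepexpE.
  apply: (le_trans (high1norm_pexp_conj _ (coef_le _) low)).
  rewrite (_ : 2 * delta * q ^+ 2 = 2 * delta * expR (2 * delta)); last first.
    by rewrite /q expRM_natl.
  apply: ler_pM; rewrite ?pauli1norm_ge0 ?sinh_le ?pauli1norm_Obwd //.
  by rewrite sinh_ge0 // mulr_ge0.
rewrite -(subrKA (\tr (X *m Apr (L - s.+1)))).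
apply: (le_trans (le_normcD _ _)); rewrite [leLHS]addrC.
apply: (le_trans (lerD (IH (ltnW hs)) (le_trans step (ler_wpM2l d0 (ler_wpM2l C0 inc))))).
rewrite -mulrDr ler_wpM2l // qL -[s.+2%:R]natr1 le_eqVlt; apply/orP; left; apply/eqP.
ring.
Qed.

End Trotter.

(** * Assembly of the truncation bound *)

Theorem mainTheorem16 (R : realType) (n M : nat) (lam : nat -> R)
  (Qs : nat -> pauli n) (w l : nat) (delta : R) (p k : nat)
  (O : 'M[R[i]]_(2 ^ n)) :
  (0 < w)%N ->
  (forall a, (a < M)%N -> `|lam a| <= 1) ->
  (forall a, (a < M)%N -> (weight (Qs a) <= w)%N) ->
  (forall i : 'I_n, (#|[set a : 'I_M | i \in supp (Qs a)]| <= l)%N) ->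
  0 < delta ->
  (1 <= k)%N ->
  adjmx O = O ->
  let beta := (p.+1)%:R * delta in
  let L := (p.+1 * M)%N in
  let g := 2 * expR 1 * beta * l%:R * w%:R * expR delta in
  g <= 1 ->
  Normc.normc (\tr (Obwd M lam Qs delta L k O L) - \tr (O *m Aprop M lam Qs delta L))
    <= (2 ^ n)%:R * expR (4 * beta * M%:R) * g ^ (Num.ceil (k%:R / w%:R : R))
       * pauli1norm O.
Proof.
move=> w0 hlam hw hl d0 k0 _ beta L g _.
have D0 : 0 <= delta by exact: ltW.
have beta0 : 0 <= beta by rewrite mulr_ge0.
have e1 : 1 <= expR 1 :> R by rewrite -[leLHS]expR0 ler_expR.
have g0 : 0 <= g by rewrite !mulr_ge0 ?expR_ge0.
have w0R : 0 < w%:R :> R by rewrite ltr0n.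
(* The ceiling is positive, so [m.-1] is a genuine predecessor and lies strictly below k/w. *)
have [m cE hm] : exists2 m : nat, Num.ceil (k%:R / w%:R : R) = m%:Z & (m.-1 * w < k)%N.
  have := ceilB1_lt (k%:R / w%:R : R).
  have : 0 < Num.ceil (k%:R / w%:R : R) by rewrite ceil_gt0 divr_gt0 ?ltr0n.
  case: (Num.ceil _) => [[|m]|] // _ h; exists m.+1 => //=.
  move: h; rewrite -[m.+1]addn1 PoszD addrK ltr_pdivlMr // -natrM ltr_nat.
  by [].
rewrite cE -exprnP.
(* With no terms [L] is zero and both traces agree; the periodic indexing requires a positive
   [M]. *)
have [M0|M0] := posnP M.
  rewrite /L M0 muln0 /= mulmx1 subrr Normc.normc0.
  by rewrite !mulr_ge0 ?exprn_ge0 ?expR_ge0 ?pauli1norm_ge0.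
set G : R := (p.+1 * l).*2%:R * sinh delta.
have G0 : 0 <= G by rewrite mulr_ge0 ?sinh_ge0.
(* After sinh delta <= delta e^delta, [g] is larger by the factor e w, which is at least 1. *)
have Gg : G <= g.
  apply: (@le_trans _ _ ((p.+1 * l).*2%:R * (delta * expR delta))).
    by rewrite ler_wpM2l ?sinh_le.
  have -> : g = (expR 1 * w%:R) * ((p.+1 * l).*2%:R * (delta * expR delta)).
    by rewrite /g /beta -muln2 !natrM; ring.
  rewrite ler_peMl ?mulr_ge0 ?expR_ge0 //.
  by rewrite mulr_ege1 // ler1n.
have := @backward_error R n M lam Qs delta M0 d0 hlam L k (G ^+ m) O L (exprn_ge0 _ G0).
rewrite subnn mulmx1 => /(_ _ (leqnn _)) h.
apply: (le_trans (h _)) => [j Q hj hQ|].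
  by apply: pcoef_Aprop_le hw hl hj _ => //; exact: leq_trans hQ.
have bL : delta * L%:R = beta * M%:R by rewrite /L /beta natrM; ring.
(* Half of the exponent 4 delta L is norm growth; the other half absorbs 1 + 2 delta L. *)
have -> : expR (4 * beta * M%:R) = expR delta ^+ L.*2 * expR (2 * delta * L%:R).
  rewrite -expRM_natl -expRD; congr expR.
  by rewrite -muln2 natrM -(mulrA 4) -bL; ring.
have gm : G ^+ m <= g ^+ m by rewrite lerXn2r ?nnegrE.
have q0 : 0 <= expR delta ^+ L.*2 by rewrite exprn_ge0 ?expR_ge0.
have N0 := pauli1norm_ge0 O.
rewrite [leRHS](_ : _ = (2 ^ n)%:R * (g ^+ m * expR delta ^+ L.*2 * pauli1norm O
  * expR (2 * delta * L%:R))); last by move: (g ^+ m) => gp; ring.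
apply: ler_wpM2l => //; apply: ler_pM; rewrite ?expR_ge1Dx //.
- by rewrite !mulr_ge0 // exprn_ge0.
- by rewrite addr_ge0 // !mulr_ge0.
- by do 2 apply: ler_wpM2r => //.
Qed.
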